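(* Let $L$ be any Kripke complete normal unimodal logic with $\mathbf{K}\subseteq L\subseteq\mathbf{S5}$. Then the bimodal product logic $L\times\mathbf{Diff}$ is not axiomatisable using finitely many propositional variables; that is, there is no set $\Sigma$ of bimodal formulas, containing altogether only finitely many distinct propositional variables, such that $L\times\mathbf{Diff}$ is the smallest normal bimodal logic containing $\Sigma$. In particular, $\mathbf{Diff}\times\mathbf{Diff}$ is not finitely axiomatisable.
   Context: Bimodal formulas are built from propositional variables, $\top,\bot,\neg,\wedge,\vee$ and the modal operators $\Box_h,\Box_v,\Diamond_h,\Diamond_v$, and are evaluated in Kripke frames $(W,R_h,R_v)$ with two binary relations in the usual way. A normal bimodal logic is a set of bimodal formulas containing all propositional tautologies and $\Box_i(p\to q)\to(\Box_ip\to\Box_iq)$ ($i=h,v$), closed under substitution, modus ponens and necessitation for $\Box_h$ and $\Box_v$. For a class $\mathcal C$ of frames, the logic of $\mathcal C$ is the set of formulas valid in every frame of $\mathcal C$; a logic is Kripke complete if it is the logic of some class of frames. $\mathbf K$ is the logic of all unimodal frames and $\mathbf{S5}$ the logic of all unimodal frames whose relation is an equivalence relation. A difference frame is a unimodal frame $(W,\neq_W)$ where $\neq_W$ is the inequality relation on a nonempty set $W$; $\mathbf{Diff}$ is the logic of all difference frames (its frames are exactly the symmetric, pseudo-transitive frames, where pseudo-transitive means $xRy\wedge yRz\to (x=z\vee xRz)$). The product of unimodal frames $(W_h,R_h)$ and $(W_v,R_v)$ is the bimodal frame $(W_h\times W_v,\bar R_h,\bar R_v)$ with $(x,y)\bar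 R_h(x',y')$ iff $xR_hx'$ and $y=y'$, and $(x,y)\bar R_v(x',y')$ iff $yR_vy'$ and $x=x'$. For Kripke complete unimodal logics $L_h,L_v$ (the first using $\Box_h,\Diamond_h$, the second $\Box_v,\Diamond_v$), their product $L_h\times L_v$ is the logic of all products $\mathfrak F_h\times\mathfrak F_v$ with $\mathfrak F_h$ a frame for $L_h$ and $\mathfrak F_v$ a frame for $L_v$. A logic is finitely axiomatisable if it is the smallest normal bimodal logic containing some finite set of formulas. *)

(* Defs.v *)
From Stdlib Require Import List.

Set Implicit Arguments.

Section Modal.

(* [M] indexes the modalities: [unit] for unimodal logic, [dir] below for
   bimodal logic. *)
Variable M : Type.

Inductive form : Type :=
| Var (n : nat)
| Top
| Bot
| Neg (A : form)
| And (A B : form)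
| Or (A B : form)
| Box (i : M) (A : form)
| Dia (i : M) (A : form).

Definition Imp (A B : form) : form := Or (Neg A) B.

Fixpoint subst (s : nat -> form) (A : form) : form :=
  match A with
  | Var n => s n
  | Top => Top
  | Bot => Bot
  | Neg B => Neg (subst s B)
  | And B C => And (subst s B) (subst s C)
  | Or B C => Or (subst s B) (subst s C)
  | Box i B => Box i (subst s B)
  | Dia i B => Dia i (subst s B)
  end.

Fixpoint occurs (n : nat) (A : form) : Prop :=
  match A with
  | Var m => n = m
  | Top | Bot => False
  | Neg B | Box _ B | Dia _ B => occurs n B
  | And B C | Or B C => occurs n B \/ occurs n C
  end.

Fixpoint modality_free (A : form) : Prop :=
  match A with
  | Var _ | Top | Bot => True
  | Neg B => modality_free B
  | And B C | Or B C => modality_free B /\ modality_free C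
  | Box _ _ | Dia _ _ => False
  end.

(* The value on modal formulas is irrelevant: [truth] is only used on
   modality-free formulas. *)
Fixpoint truth (v : nat -> bool) (A : form) : bool :=
  match A with
  | Var n => v n
  | Top => true
  | Bot => false
  | Neg B => negb (truth v B)
  | And B C => andb (truth v B) (truth v C)
  | Or B C => orb (truth v B) (truth v C)
  | Box _ _ | Dia _ _ => false
  end.

Definition tautology (A : form) : Prop :=
  modality_free A /\ forall v : nat -> bool, truth v A = true.

Record frame : Type := Frame {
  world : Type;
  world_inhabited : inhabited world;
  rel : M -> world -> world -> Prop
}.

Fixpoint forces (F : frame) (V : nat -> world F -> Prop) (w : world F)
    (A : form) : Prop :=
  match A with
  | Var n => V n w
  | Top => True
  | Bot => False
  | Neg B => ~ forces F V w B
  | And B C => forces F V w B /\ forces F V w C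
  | Or B C => forces F V w B \/ forces F V w C
  | Box i B => forall u, rel F i w u -> forces F V u B
  | Dia i B => exists u, rel F i w u /\ forces F V u B
  end.

Definition valid (F : frame) (A : form) : Prop :=
  forall (V : nat -> world F -> Prop) (w : world F), forces F V w A.

Definition included (L L' : form -> Prop) : Prop := forall A, L A -> L' A.

Definition logic_of (C : frame -> Prop) : form -> Prop :=
  fun A => forall F, C F -> valid F A.

Definition frame_for (L : form -> Prop) (F : frame) : Prop :=
  forall A, L A -> valid F A.

Definition kripke_complete (L : form -> Prop) : Prop :=
  exists C : frame -> Prop, forall A, L A <-> logic_of C A.

(* Since [Dia] is primitive, its duality with [Box] does not belong to every
   normal logic.  This does not affect axiomatisability of a Kripke complete
   logic: the duality is a one-variable formula per modality, valid in all
   frames, which a set of axioms may contain. *)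
Record normal_logic (L : form -> Prop) : Prop := {
  normal_taut : forall A, tautology A -> L A;
  normal_K : forall i,
    L (Imp (Box i (Imp (Var 0) (Var 1)))
           (Imp (Box i (Var 0)) (Box i (Var 1))));
  normal_subst : forall s A, L A -> L (subst s A);
  normal_mp : forall A B, L (Imp A B) -> L A -> L B;
  normal_nec : forall i A, L A -> L (Box i A)
}.

Definition axiomatised_by (Sigma L : form -> Prop) : Prop :=
  normal_logic L /\ included Sigma L /\
  forall L', normal_logic L' -> included Sigma L' -> included L L'.

Definition finitely_many_variables (Sigma : form -> Prop) : Prop :=
  exists vars : list nat, forall A n, Sigma A -> occurs n A -> In n vars.

Definition finitely_axiomatisable (L : form -> Prop) : Prop :=
  exists Sigma : list form, axiomatised_by (fun A => In A Sigma) L.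

End Modal.

Definition logic_K : form unit -> Prop := logic_of (fun _ => True).

Definition equivalence_frame (F : frame unit) : Prop :=
  (forall x, rel F tt x x) /\
  (forall x y, rel F tt x y -> rel F tt y x) /\
  (forall x y z, rel F tt x y -> rel F tt y z -> rel F tt x z).

Definition logic_S5 : form unit -> Prop := logic_of equivalence_frame.

Definition difference_frame (F : frame unit) : Prop :=
  forall x y, rel F tt x y <-> x <> y.

Definition logic_Diff : form unit -> Prop := logic_of difference_frame.

Inductive dir : Type := Hor | Ver.

Lemma inhabited_prod (A B : Type) :
  inhabited A -> inhabited B -> inhabited (A * B).
Proof. intros [a] [b]; exact (inhabits (a, b)). Qed.

Definition product_frame (Fh Fv : frame unit) : frame dir :=
  {| world := (world Fh * world Fv)%type;
     world_inhabited :=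
       inhabited_prod (world_inhabited Fh) (world_inhabited Fv);
     rel := fun i p q =>
       match i with
       | Hor => rel Fh tt (fst p) (fst q) /\ snd p = snd q
       | Ver => rel Fv tt (snd p) (snd q) /\ fst p = fst q
       end |}.

Definition product_logic (Lh Lv : form unit -> Prop) : form dir -> Prop :=
  logic_of (fun F => exists Fh Fv : frame unit,
    frame_for Lh Fh /\ frame_for Lv Fv /\ F = product_frame Fh Fv).

(* Main.v *)
(** Let [a = 2 ^ k + 1], where [k] is the number of available variables, and
    consider the frame on [nat] whose horizontal relation is universal and whose
    vertical relation is inequality inside each of the two classes [w < a] and
    [a <= w].  It refutes a formula valid in every product with a [Diff]-frame,
    namely that no column is larger than one of exactly [a] irreflexive points.
    On the other hand, for any valuation two points of the finite class agree on
    all [k] variables; letting one of them absorb infinitely many points turns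
    the finite class into a column of the same size as the infinite one, so the
    [k]-variable model is bisimilar to a model on the product of a universal
    frame and an infinite difference frame.  Hence axioms in [k] variables
    cannot separate this frame from the frames of the product logic. *)

Require Import Defs.
From Stdlib Require Import List Arith Lia Classical ClassicalEpsilon FinFun.
Import ListNotations.

Set Implicit Arguments.

(** * Kripke semantics *)

Lemma forces_imp M (F : frame M) V w A B :
  forces F V w (Imp A B) <-> (forces F V w A -> forces F V w B).
Proof. simpl; destruct (classic (forces F V w A)); tauto. Qed.

Lemma forces_truth M (F : frame M) V w (v : nat -> bool)
    (vE : forall n, V n w <-> v n = true) (A : form M) :
  modality_free A -> forces F V w A <-> truth v A = true.
Proof.
  induction A; simpl; intros H; try tauto; try (split; easy).
  - apply vE.
  - rewrite IHA by exact H; destruct (truth v A); simpl; split; easy.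
  - rewrite Bool.andb_true_iff; tauto.
  - rewrite Bool.orb_true_iff; tauto.
Qed.

Lemma forces_subst M (F : frame M) V s (A : form M) :
  forall w, forces F V w (subst s A) <->
            forces F (fun n u => forces F V u (s n)) w A.
Proof.
  induction A as [| | | A IH | A IHA B IHB | A IHA B IHB | i A IH | i A IH];
    simpl; intros w; try tauto.
  - rewrite IH; tauto.
  - rewrite IHA, IHB; tauto.
  - rewrite IHA, IHB; tauto.
  - split; intros H u Hu; apply IH, H, Hu.
  - split; intros [u [Hu H]]; exists u; split; [| apply IH | | apply IH]; easy.
Qed.

Lemma logic_of_normal M (C : frame M -> Prop) : normal_logic (logic_of C).
Proof.
  split.
  - intros A [free taut] F _ V w.
    set (v n := if excluded_middle_informative (V n w) then true else false).
    apply (@forces_truth _ F V w v); [| exact free | apply taut].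
    intros n; unfold v; destruct (excluded_middle_informative (V n w)); easy.
  - intros i F _ V w; rewrite !forces_imp.
    intros Himp Hbox u Hu.
    apply (proj1 (forces_imp F V u (Var M 0) (Var M 1)) (Himp u Hu)), Hbox, Hu.
  - intros s A HA F CF V w; apply forces_subst, HA, CF.
  - intros A B HAB HA F CF V w.
    specialize (HAB F CF V w); rewrite forces_imp in HAB.
    apply HAB, HA, CF.
  - intros i A HA F CF V w u _; apply HA, CF.
Qed.

(** Atoms need to agree only on [P], so two models can be compared on the formulas over the
    available variables while differing on all others. *)
Lemma bisimulation_forces M (F G : frame M) V V' (P : nat -> Prop)
    (Z : world F -> world G -> Prop)
    (atoms : forall n w u, P n -> Z w u -> V n w <-> V' n u)
    (forth : forall i w u w', Z w u -> rel F i w w' ->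
       exists u', rel G i u u' /\ Z w' u')
    (back : forall i w u u', Z w u -> rel G i u u' ->
       exists w', rel F i w w' /\ Z w' u')
    (A : form M) :
  (forall n, occurs n A -> P n) ->
  forall w u, Z w u -> forces F V w A <-> forces G V' u A.
Proof.
  induction A as [n | | | A IH | A IHA B IHB | A IHA B IHB | i A IH | i A IH];
    simpl; intros occ w u Zwu; try tauto.
  - apply atoms; auto.
  - rewrite (IH occ w u Zwu); tauto.
  - rewrite (IHA (fun n o => occ n (or_introl o)) w u Zwu),
      (IHB (fun n o => occ n (or_intror o)) w u Zwu); tauto.
  - rewrite (IHA (fun n o => occ n (or_introl o)) w u Zwu),
      (IHB (fun n o => occ n (or_intror o)) w u Zwu); tauto.
  - split; intros H x Hx.
    + destruct (back i w u x Zwu Hx) as [y [Hy Zyx]].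
      apply (IH occ y x Zyx), H, Hy.
    + destruct (forth i w u x Zwu Hx) as [y [Hy Zxy]].
      apply (IH occ x y Zxy), H, Hy.
  - split; intros [x [Hx H]].
    + destruct (forth i w u x Zwu Hx) as [y [Hy Zxy]].
      exists y; split; [exact Hy | apply (IH occ x y Zxy), H].
    + destruct (back i w u x Zwu Hx) as [y [Hy Zyx]].
      exists y; split; [exact Hy | apply (IH occ y x Zyx), H].
Qed.

(** * Frames for [Diff] *)

(** Correspondence: the symmetry axiom is evaluated with its variable true at [x] alone.
    Pseudo-transitivity below is obtained likewise, with the variable true at [z] alone. *)
Lemma frame_for_Diff_symmetric (F : frame unit) :
  frame_for logic_Diff F -> forall x y, rel F tt x y -> rel F tt y x.
Proof.
  intros HF x y Rxy.
  assert (HD : logic_Diff (Imp (Var _ 0) (Box tt (Dia tt (Var _ 0))))).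
  { intros G HG V w; rewrite forces_imp; simpl; intros Hw u Hu.
    exists w; split; [| exact Hw].
    apply HG in Hu; apply HG; congruence. }
  specialize (HF _ HD (fun _ z => z = x) x).
  rewrite forces_imp in HF; simpl in HF.
  destruct (HF eq_refl y Rxy) as [z [Ryz ->]]; exact Ryz.
Qed.

Lemma frame_for_Diff_pseudo_transitive (F : frame unit) :
  frame_for logic_Diff F ->
  forall x y z, rel F tt x y -> rel F tt y z -> x <> z -> rel F tt x z.
Proof.
  intros HF x y z Rxy Ryz Nxz.
  assert (HD : logic_Diff (Imp (Dia tt (Dia tt (Var _ 0)))
                               (Or (Var _ 0) (Dia tt (Var _ 0))))).
  { intros G HG V w; rewrite forces_imp; simpl; intros [u [_ [t [_ Ht]]]].
    destruct (classic (w = t)) as [-> | N]; [now left | right].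
    exists t; split; [apply HG, N | exact Ht]. }
  specialize (HF _ HD (fun _ t => t = z) x).
  rewrite forces_imp in HF; simpl in HF.
  destruct HF as [E | [t [Rxt ->]]]; [| easy | exact Rxt].
  exists y; split; [exact Rxy | now exists z].
Qed.

(* A cluster is an image of the difference frame on two copies of it. *)
Lemma Diff_included_S5 : included logic_Diff logic_S5.
Proof.
  intros A HA F [Frefl [Fsym Ftrans]] V w.
  set (D := {p : world F * bool | rel F tt w (fst p)}).
  set (d0 := exist _ (w, true) (Frefl w) : D).
  set (G := @Frame unit D (inhabits d0) (fun _ p q => p <> q)).
  assert (HG : difference_frame G) by (intros x y; reflexivity).
  refine (proj1 (@bisimulation_forces _ G F
    (fun n p => V n (fst (proj1_sig p))) V (fun _ => True)
    (fun p u => fst (proj1_sig p) = u) _ _ _ A (fun _ _ => I) d0 w eq_refl)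
    (HA G HG _ d0)).
  - intros n p u _ <-; reflexivity.
  - intros [] [p Hp] u [q Hq] <- _; exists (fst q); split; [| reflexivity].
    simpl in *; eauto.
  - intros [] [[v b] Hp] u u' E Ru; simpl in *; subst v.
    exists (exist (fun p => rel F tt w (fst p)) (u', negb b) (Ftrans _ _ _ Hp Ru)).
    split; [| reflexivity].
    intros E; apply (f_equal (@proj1_sig _ _)) in E; simpl in E.
    destruct b; discriminate.
Qed.

(** * Columns of bounded size *)

Definition disj M (f : nat -> form M) (l : list nat) : form M :=
  fold_right (fun i A => Or (f i) A) (Bot M) l.

Definition conj M (f : nat -> form M) (l : list nat) : form M :=
  fold_right (fun i A => And (f i) A) (Top M) l.

Lemma forces_disj M (F : frame M) V w f l :
  forces F V w (disj f l) <-> exists i, In i l /\ forces F V w (f i).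
Proof.
  induction l as [| j l IH]; simpl; [split; [easy | now intros [i []]] |].
  rewrite IH; split.
  - intros [H | [i [Hi H]]]; [exists j | exists i]; tauto.
  - intros [i [[-> | Hi] H]]; [now left | right; eauto].
Qed.

Lemma forces_conj M (F : frame M) V w f l :
  forces F V w (conj f l) <-> forall i, In i l -> forces F V w (f i).
Proof.
  induction l as [| j l IH]; simpl; [split; [intros _ i [] | easy] |].
  rewrite IH; split.
  - intros [Hj Hl] i [<- | Hi]; auto.
  - auto.
Qed.

(** Each point carries one of [a] variables that is false at all its vertical successors. Distinct
    points of a [Diff] cluster see each other, so such a column has at most [a] points, all
    irreflexive. *)
Definition column_of_size (a : nat) : form dir :=
  let A := disj (fun i => And (Var _ i) (Box Ver (Neg (Var _ i)))) (seq 0 a) in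
  And A (Box Ver A).

(** The point demanded for [i] has [i] as its first true variable, so the [S a] points are pairwise
    distinct. *)
Definition column_exceeds (a : nat) : form dir :=
  conj (fun i =>
    let A := And (Var _ i) (conj (fun j => Neg (Var _ j)) (seq 0 i)) in
    Or A (Dia Ver A)) (seq 0 (S a)).

Definition equinumerous_columns (a : nat) : form dir :=
  Neg (And (column_of_size a) (Dia Hor (column_exceeds a))).

(** All columns of a product share the vertical frame, so the [S a] points found over [x'] also lie
    over [x], where they would need distinct colours out of only [a]. *)
Lemma equinumerous_columns_valid (L : form unit -> Prop) (a : nat) :
  product_logic L logic_Diff (equinumerous_columns a).
Proof.
  intros F [Fh [Fv [_ [HD ->]]]] V [x y].
  unfold equinumerous_columns, column_of_size, column_exceeds.
  intros [[Hy HR] [[x' y'] [[_ E] Hmany]]]; simpl in E; subst y'.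
  pose (cls z := z = y \/ rel Fv tt y z).
  assert (clsR : forall z z', cls z -> cls z' -> z <> z' -> rel Fv tt z z').
  { intros z z' [-> | Hz] [-> | Hz'] N; try easy.
    - now apply frame_for_Diff_symmetric.
    - apply frame_for_Diff_pseudo_transitive with y; trivial.
      now apply frame_for_Diff_symmetric. }
  assert (Hcol : forall z, cls z -> exists i, i < a /\ V i (x, z) /\
                   forall z', rel Fv tt z z' -> ~ V i (x, z')).
  { intros z Hz.
    assert (H : exists i, In i (seq 0 a) /\
      forces (product_frame Fh Fv) V (x, z)
        (And (Var _ i) (Box Ver (Neg (Var _ i))))).
    { apply forces_disj; destruct Hz as [-> | Hz]; [exact Hy |].
      apply HR; now split. }
    destruct H as [i [Hi [Vi Hbox]]]; apply in_seq in Hi.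
    exists i; repeat split; [lia | exact Vi |].
    intros z' Hz'; apply (Hbox (x, z')); now split. }
  (* The bound on [i] sits under the existential so that choice yields a total function; [y] is a
     dummy value beyond [a]. *)
  assert (Hpts : forall i, exists z, i < S a ->
            cls z /\ V i (x', z) /\ forall j, j < i -> ~ V j (x', z)).
  { intros i; destruct (le_lt_dec (S a) i) as [Hi | Hi]; [exists y; lia |].
    assert (H : exists z, cls z /\ forces (product_frame Fh Fv) V (x', z)
       (And (Var _ i) (conj (fun j => Neg (Var _ j)) (seq 0 i)))).
    { rewrite forces_conj in Hmany.
      destruct (Hmany i) as [H | [[x1 z] [[Hz E] H]]]; [apply in_seq; lia | |].
      - exists y; split; [now left | exact H].
      - simpl in E, Hz; subst x1; exists z; split; [now right | exact H]. }
    destruct H as [z [Hz [Vi H]]]; rewrite forces_conj in H.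
    exists z; intros _; repeat split; [exact Hz | exact Vi |].
    intros j Hj; apply (H j), in_seq; lia. }
  apply choice in Hpts; destruct Hpts as [pt Hpt].
  assert (Hcolor : forall i, exists c, i < S a -> c < a /\ V c (x, pt i) /\
            forall z', rel Fv tt (pt i) z' -> ~ V c (x, z')).
  { intros i; destruct (le_lt_dec (S a) i) as [Hi | Hi]; [exists 0; lia |].
    destruct (Hcol (pt i)) as [c Hc]; [now apply Hpt | now exists c]. }
  apply choice in Hcolor; destruct Hcolor as [c Hc].
  assert (pt_inj : forall i j, i < S a -> j < i -> pt i <> pt j).
  { intros i j Hi Hj E.
    destruct (Hpt i Hi) as [_ [_ N]], (Hpt j) as [_ [Vj _]]; [lia |].
    apply (N j Hj); now rewrite E. }
  assert (c_inj : forall i j, i < S a -> j < S a -> c i = c j -> i = j).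
  { intros i j Hi Hj E; apply NNPP; intros Nij.
    destruct (Hc i Hi) as [_ [_ N]], (Hc j Hj) as [_ [Vj _]].
    apply (N (pt j)); [| now rewrite E].
    apply clsR; [apply Hpt, Hi | apply Hpt, Hj |].
    destruct (Nat.lt_total i j) as [H | [H | H]]; [| easy |].
    - apply not_eq_sym; now apply pt_inj.
    - now apply pt_inj. }
  assert (len : length (map c (seq 0 (S a))) <= length (seq 0 a)).
  { apply NoDup_incl_length.
    - apply Injective_map_NoDup_in; [| apply seq_NoDup].
      intros i j Hi Hj; apply in_seq in Hi, Hj; apply c_inj; lia.
    - intros k Hk; apply in_map_iff in Hk; destruct Hk as [i [<- Hi]].
      apply in_seq in Hi; apply in_seq.
      destruct (Hc i) as [H _]; lia. }
  rewrite length_map, !length_seq in len; lia.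
Qed.

(** * Two columns of different sizes *)

Section TwoColumns.

Variable a : nat.

Definition same_column (w u : nat) : Prop := w < a <-> u < a.

Definition two_columns : frame dir :=
  @Frame dir nat (inhabits 0) (fun i w u =>
    match i with
    | Hor => True
    | Ver => w <> u /\ same_column w u
    end).

Lemma two_columns_refutes :
  0 < a -> ~ valid two_columns (equinumerous_columns a).
Proof.
  intros apos H.
  (* For [i < a], variable [i] names one point in each class. In the infinite class, [a + i] has [i]
     as its first true variable. *)
  apply (H (fun i w => w = i \/ w = a + i) 0); split.
  - assert (Hall : forall w, w < a -> exists i, In i (seq 0 a) /\
      forces two_columns (fun i w => w = i \/ w = a + i) w
        (And (Var _ i) (Box Ver (Neg (Var _ i))))).
    { intros w Hw; exists w; split; [apply in_seq; lia |].
      simpl; split; [now left |].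
      unfold same_column; intros u Hu; lia. }
    split.
    + apply forces_disj, Hall, apos.
    + intros u [_ Hu]; apply forces_disj, Hall, Hu, apos.
  - exists a; split; [exact I |].
    apply forces_conj; intros i _.
    assert (Hi : forces two_columns (fun i w => w = i \/ w = a + i) (a + i)
      (And (Var _ i) (conj (fun j => Neg (Var _ j)) (seq 0 i)))).
    { split; [simpl; now right |].
      apply forces_conj; intros j Hj; apply in_seq in Hj; simpl; lia. }
    (* The point [a] does not see itself vertically, so it serves [i = 0] through the first
       disjunct. *)
    destruct (Nat.eq_dec i 0) as [E | N].
    + left; rewrite (ltac:(lia) : a + i = a) in Hi; exact Hi.
    + right; exists (a + i); split; [| exact Hi].
      simpl; unfold same_column; lia.
Qed.

Variable V : nat -> nat -> Prop.
Variable vars : list nat.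

Definition same_type (w u : nat) : Prop :=
  forall n, In n vars -> V n w <-> V n u.

(* [g] lists the points of a column, up to repetition of points whose type is
   realised twice in that column anyway. *)
Record covers_column (g : nat -> nat) : Prop := {
  covers_same : forall d e, same_column (g d) (g e);
  covers_onto : forall d w, same_column (g d) w -> exists e, g e = w;
  covers_repeated : forall d e, g d = g e -> d <> e ->
    exists w, w <> g d /\ same_column (g d) w /\ same_type (g d) w
}.

Definition swap (p q d : nat) : nat :=
  if Nat.eq_dec d p then q else if Nat.eq_dec d q then p else d.

Lemma swapK p q d : swap p q (swap p q d) = d.
Proof.
  unfold swap.
  repeat (destruct Nat.eq_dec; try congruence).
Qed.

Lemma covers_swap g p q :
  covers_column g -> covers_column (fun d => g (swap p q d)).
Proof.
  intros [same onto rep]; split.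
  - intros d e; apply same.
  - intros d w H; destruct (onto _ _ H) as [e <-].
    exists (swap p q e); now rewrite swapK.
  - intros d e E N; apply rep with (swap p q e); [exact E |].
    intros E'; apply N; now rewrite <- (swapK p q d), E', swapK.
Qed.

(** A shift enumerates the infinite class. In the finite class [i] absorbs all indices from [a] on,
    and its twin [j] makes the repetition harmless. A transposition then brings [w] to index [d], so
    a horizontal step can reach any point. *)
Lemma covering_through i j d w :
  i < a -> j < a -> i <> j -> same_type i j ->
  exists g, covers_column g /\ g d = w.
Proof.
  intros Hi Hj Nij Tij.
  assert (H : exists g e, covers_column g /\ g e = w).
  { destruct (le_lt_dec a w) as [Hw | Hw].
    - exists (fun d => a + d), (w - a); split; [| lia].
      split; unfold same_column; intros d'; [lia | | lia].
      intros u Hu; exists (u - a); lia.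
    - exists (fun d => if le_lt_dec a d then i else d), w; split.
      + split; unfold same_column; intros d'.
        * intros e; destruct (le_lt_dec a d'), (le_lt_dec a e); lia.
        * intros u Hu; exists u.
          destruct (le_lt_dec a d'), (le_lt_dec a u); lia.
        * intros e E N.
          (* The map is the identity below [a], so only the value [i] can be repeated. *)
          assert (E' : (if le_lt_dec a d' then i else d') = i)
            by (destruct (le_lt_dec a d'), (le_lt_dec a e); lia).
          rewrite E'; exists j; split; [auto | split; [tauto | exact Tij]].
      + destruct (le_lt_dec a w); lia. }
  destruct H as [g [e [Hg E]]].
  exists (fun x => g (swap d e x)); split; [now apply covers_swap |].
  unfold swap; destruct Nat.eq_dec; congruence.
Qed.

(** Horizontal worlds are the coverings, vertical ones their indices, and [(g, d)] stands for [g d].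
    The bisimulation identifies points of equal column and type: changing the index may leave [g d]
    fixed, whereas a vertical step in [two_columns] never stays put. *)
Lemma two_columns_forces (A : form dir) i j :
  i < a -> j < a -> i <> j -> same_type i j ->
  (forall F D, equivalence_frame F -> difference_frame D ->
     valid (product_frame F D) A) ->
  (forall n, occurs n A -> In n vars) ->
  forall w, forces two_columns V w A.
Proof.
  intros Hi Hj Nij Tij HA occ w.
  destruct (covering_through 0 w Hi Hj Nij Tij) as [g0 [Hg0 Eg0]].
  set (U := {g | covers_column g}).
  set (c0 := exist _ g0 Hg0 : U).
  set (F := @Frame unit U (inhabits c0) (fun _ _ _ => True)).
  set (D := @Frame unit nat (inhabits 0) (fun _ x y => x <> y)).
  assert (HF : equivalence_frame F) by (repeat split).
  assert (HD : difference_frame D) by (intros x y; reflexivity).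
  pose (pt (p : U * nat) := proj1_sig (fst p) (snd p)).
  refine (proj1 (@bisimulation_forces _ (product_frame F D) two_columns
    (fun n p => V n (pt p)) V (fun n => In n vars)
    (fun p u => same_column (pt p) u /\ same_type (pt p) u)
    _ _ _ A occ (c0, 0) w _) (HA F D HF HD _ (c0, 0))).
  - intros n p u Hn [_ T]; now apply T.
  - intros [] [[g Hg] d] u [[g' Hg'] e] [S T] [R E]; unfold pt in *; simpl in *.
    + subst e; exists (g' d); repeat split; tauto.
    + injection E as <-.
      pose proof (covers_same Hg d e) as Sde; unfold same_column, same_type in *.
      (* If [g e] is [u], the answer must be another point of its type: [g d] if that differs from
         [u], otherwise the twin of the repeated value. *)
      destruct (Nat.eq_dec (g e) u) as [Eu | Nu].
      * destruct (Nat.eq_dec (g d) u) as [Ed | Nd].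
        -- destruct (covers_repeated Hg (d := d) (e := e)) as [v [Nv [Sv Tv]]];
             [congruence | exact R |].
           unfold same_column, same_type in *; rewrite <- Eu in *.
           exists v; rewrite Ed in *; repeat split; try tauto; auto;
             apply Tv; assumption.
        -- exists (g d); rewrite Eu in *; repeat split; try tauto; auto;
             apply T; assumption.
      * exists (g e); repeat split; try tauto; auto.
  - intros [] [[g Hg] d] u u' [S T] R; unfold pt in *; simpl in *.
    + destruct (covering_through d u' Hi Hj Nij Tij) as [g' [Hg' E]].
      exists (exist _ g' Hg', d); simpl; rewrite E.
      unfold same_column, same_type; repeat split; tauto.
    + destruct R as [Nu Su].
      assert (Su' : same_column (g d) u') by (unfold same_column in *; tauto).
      destruct (covers_onto Hg d Su') as [e Ee].
      (* If [u'] is [g d] itself, the index of [u] is used instead: [u] has the type of [g d] and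
         differs from [u']. *)
      destruct (Nat.eq_dec d e) as [Ed | Nd].
      * subst e; destruct (covers_onto Hg d S) as [e Ee'].
        exists (exist _ g Hg, e); simpl; rewrite Ee', <- Ee.
        repeat split; try (intros E; subst e; congruence);
          unfold same_column, same_type in *; try tauto;
          apply T; assumption.
      * exists (exist _ g Hg, e); simpl; rewrite Ee.
        unfold same_column, same_type; repeat split; tauto.
  - unfold pt; simpl; rewrite Eg0.
    unfold same_column, same_type; split; [tauto | intros; tauto].
Qed.

End TwoColumns.

(** * Counting types, and non-axiomatisability *)

(** Each variable splits the list in two, and one part keeps more than half of the bound. *)
Lemma same_type_pigeonhole (V : nat -> nat -> Prop) (vars : list nat) :
  forall l, NoDup l -> 2 ^ length vars < length l ->
  exists i j, In i l /\ In j l /\ i <> j /\ same_type V vars i j.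
Proof.
  induction vars as [| n vars IH]; simpl; intros l Hl len.
  - destruct l as [| i [| j l]]; simpl in len; try lia.
    exists i, j; simpl; repeat split; auto; try contradiction.
    intros ->; inversion Hl as [| ? ? Hni]; apply Hni; now left.
  - set (b w := if excluded_middle_informative (V n w) then true else false).
    assert (H : exists v : bool,
        2 ^ length vars < length (filter (fun w => Bool.eqb v (b w)) l)).
    { pose proof (filter_length b l) as Hlen.
      destruct (le_lt_dec (length (filter b l)) (2 ^ length vars)).
      - exists false; rewrite (filter_ext _ (fun w => negb (b w))); [lia |].
        intros w; now destruct (b w).
      - exists true; rewrite (filter_ext _ b); [lia |].
        intros w; now destruct (b w). }
    destruct H as [v Hv].
    destruct (IH _ (NoDup_filter _ Hl) Hv) as [i [j [Hi [Hj [N T]]]]].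
    apply filter_In in Hi, Hj; destruct Hi as [Hi Ei], Hj as [Hj Ej].
    exists i, j; repeat split; trivial; destruct H as [<- | H];
      try (now apply T); apply Bool.eqb_prop in Ei, Ej;
      unfold b in Ei, Ej;
      destruct (excluded_middle_informative (V n i)),
        (excluded_middle_informative (V n j)); easy || congruence.
Qed.

Lemma product_Diff_not_axiomatisable (L : form unit -> Prop) :
  included L logic_S5 ->
  ~ exists Sigma : form dir -> Prop,
      finitely_many_variables Sigma /\
      axiomatised_by Sigma (product_logic L logic_Diff).
Proof.
  intros LS5 [Sigma [[vars Hvars] [_ [Hsub Hmin]]]].
  (* One more than the number of types over [vars], so the finite class contains twins. *)
  set (a := S (2 ^ length vars)).
  assert (HSigma : included Sigma (logic_of (eq (two_columns a)))).
  { intros A HA F <- V w.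
    destruct (@same_type_pigeonhole V vars (seq 0 a))
      as [i [j [Hi [Hj [N T]]]]];
      [apply seq_NoDup | rewrite length_seq; unfold a; lia |].
    apply in_seq in Hi, Hj.
    apply (@two_columns_forces a V vars A i j); try lia; trivial.
    - intros F D HF HD; apply (Hsub A HA).
      exists F, D; split; [| split; [| reflexivity]].
      + intros B HB; exact (LS5 B HB F HF).
      + intros B HB; exact (HB D HD).
    - intros n; apply Hvars, HA. }
  apply (@two_columns_refutes a); [unfold a; lia |].
  (* Minimality is applied to the logic of the single frame [two_columns a], which contains all the
     axioms. *)
  apply (Hmin _ (logic_of_normal _) HSigma); [| reflexivity].
  apply equinumerous_columns_valid.
Qed.

Lemma occurs_finite M (A : form M) :
  exists vars, forall n, occurs n A -> In n vars.
Proof.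
  induction A as [m | | | A IH | A [l IHA] B [l' IHB] | A [l IHA] B [l' IHB]
                 | i A IH | i A IH]; simpl; trivial.
  - exists [m]; simpl; auto.
  - now exists [].
  - now exists [].
  - exists (l ++ l'); intros n; rewrite in_app_iff; firstorder.
  - exists (l ++ l'); intros n; rewrite in_app_iff; firstorder.
Qed.

Lemma finite_finitely_many_variables M (Sigma : list (form M)) :
  finitely_many_variables (fun A => In A Sigma).
Proof.
  induction Sigma as [| B Sigma [l IH]].
  - now exists [].
  - destruct (occurs_finite B) as [l' HB]; exists (l ++ l').
    intros A n [<- | HA] Hn; apply in_app_iff; eauto.
Qed.

Theorem theorem2p1 :
  (forall L : form unit -> Prop,
      normal_logic L -> kripke_complete L ->
      included logic_K L -> included L logic_S5 ->
      ~ exists Sigma : form dir -> Prop,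
          finitely_many_variables Sigma /\
          axiomatised_by Sigma (product_logic L logic_Diff)) /\
  ~ finitely_axiomatisable (product_logic logic_Diff logic_Diff).
Proof.
  split.
  - intros L _ _ _; apply product_Diff_not_axiomatisable.
  - intros [Sigma HSigma].
    apply (product_Diff_not_axiomatisable Diff_included_S5).
    exists (fun A => In A Sigma); split; [| exact HSigma].
    apply finite_finitely_many_variables.
Qed.
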